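(* Let $n$ be an integer with $2\le n\le 14$. If $v_1,\dots,v_n\in\mathbb{R}^n$ are unit vectors such that $$\sup_{\|x\|=1}|\langle x,v_1\rangle\cdots\langle x,v_n\rangle| = n^{-n/2},$$ where the supremum is over unit vectors $x\in\mathbb{R}^n$, then $\{v_i\}_{i=1}^n$ is an orthonormal system.
   Context: $\mathbb{R}^n$ carries the standard inner product $\langle\cdot,\cdot\rangle$ and Euclidean norm $\|\cdot\|$. *)

(* Defs.v *)
From HB Require Import structures.
From mathcomp Require Import all_boot all_order all_algebra.
From mathcomp Require Import classical_sets reals exp.

Set Implicit Arguments.
Unset Strict Implicit.
Unset Printing Implicit Defensive.

Import Order.TTheory GRing.Theory Num.Theory.

Local Open Scope ring_scope.

Definition dotv (R : realType) (n : nat) (x y : 'rV[R]_n) : R :=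
  \sum_(i < n) x 0 i * y 0 i.

(* The norm [`|x|] that MathComp-Analysis puts on ['rV[R]_n] is the sup norm,
   hence a separate Euclidean norm. *)
Definition enorm (R : realType) (n : nat) (x : 'rV[R]_n) : R :=
  Num.sqrt (dotv x x).

(* Orthonormality of the indexed family: in particular the vectors are
   pairwise distinct. *)
Definition orthonormal_system (R : realType) (n : nat) (I : eqType)
    (v : I -> 'rV[R]_n) : Prop :=
  forall i j : I, dotv (v i) (v j) = (i == j)%:R.

(* [sup] is the real supremum, which defaults to 0 on empty or unbounded sets.
   For n >= 1 the sphere is nonempty, and the product is bounded on it, so this
   is the actual supremum. *)
Definition sup_abs_prod (R : realType) (n m : nat) (v : 'I_m -> 'rV[R]_n) : R :=
  sup [set `|\prod_(i < m) dotv x (v i)|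
      | x in [set x : 'rV[R]_n | enorm x = 1]]%classic.

(* Main.v *)
Require Import Defs.
From HB Require Import structures.
From mathcomp Require Import all_boot all_order all_algebra.
From mathcomp Require Import classical_sets reals exp.
From mathcomp Require Import ring lra.

(** Choose signs [e i] for which [w = \sum_i (-1) ^+ e i *: v i] is as long as
    possible, let [S] be its squared norm and put
    [a i = (-1) ^+ e i * dotv w (v i)].  Flipping one sign cannot lengthen [w],
    which forces [1 <= a i] (Bang's argument, [maximal_signs_ge1]).  The [a i]
    sum to [S], hence [n <= S], and each is at most [sqrt S] by Cauchy-Schwarz.

    If [S = n], every [a i] equals 1, so flipping any sign gives another
    maximal choice.  Comparing the values [a i = 1] before and after flipping
    the sign of [v j] gives [dotv (v j) (v i) = 0]
    ([orthonormal_of_maximal_signs]).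

    If [n < S], the unit vector [w / sqrt S] makes the product of the linear
    forms equal to [\prod_i a i / S ^ (n/2)], and this exceeds [n ^ (- n/2)]:
    this is the inequality [\prod_i a i > (S / n) ^ (n/2)] of [sum_ln_gt],
    the only place where [n <= 14] matters.  To prove it put [t = S - n].
    Since [N * ln (1 + t / N)] increases with [N], the right-hand side may be
    replaced by [(1 + t / 14) ^ 7]; set [u = sqrt (14 + t)], so that every
    [a i] lies between 1 and [u].
    - For small [u], the bound [\prod_i a i >= 1 + t] suffices.
    - For large [u], concavity of [ln] on [1, u] gives
      [\sum_i ln (a i) >= t / (u - 1) * ln u], and what remains is
      [u (14 - u) / (u - 1) * ln u < 7 * ln 14].
    For 14 numbers both bounds are exact when one [a i] equals [u] and the
    others equal 1, that is when [u ^ 2 - u = 13]; the two regimes are therefore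
    separated near there, at [cut = 265 / 64].  There the claim amounts to
    [cut ^ 13 < 14 ^ 7], whose two sides differ by a quarter of a percent. *)

Set Implicit Arguments.
Unset Strict Implicit.
Unset Printing Implicit Defensive.

Import Order.TTheory GRing.Theory Num.Theory.

Local Open Scope ring_scope.

(** * Inequalities for logarithms and products *)

Lemma ln_le_tangent (R : realType) (x y : R) :
  0 < x -> 0 < y -> ln y <= ln x + (y - x) / x.
Proof.
move=> x0 y0; rewrite -lerBlDl -ln_div ?posrE//.
have -> : y / x = 1 + (y - x) / x by field; lra.
apply: le_ln1Dx; rewrite mulrBl divff ?gt_eqF//.
by have := divr_gt0 y0 x0; lra.
Qed.

(** Concavity: at [a], both end points of the chord over [1, b] lie below the
    tangent, and the weights [b - a] and [a - 1] cancel its slope. *)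
Lemma ln_ge_chord (R : realType) (a b : R) :
  1 <= a <= b -> (a - 1) * ln b <= (b - 1) * ln a.
Proof.
move=> /andP[a1 ab].
have a0 : 0 < a by lra.
have b0 : 0 < b by lra.
have := ln_le_tangent a0 ltr01; rewrite ln1 => h1.
have hb := ln_le_tangent a0 b0.
have e : (b - a) * ((1 - a) / a) + (a - 1) * ((b - a) / a) = 0 by field; lra.
nra.
Qed.

(** Concavity again: [1 + t / N] is the mean of [n] copies of [1 + t / n] and
    [N - n] copies of [1], so the tangent at [1 + t / N] bounds the left side.
    This reduces every [n <= 14] to the numbers for 14. *)
Lemma muln_ln_pad_le (R : realType) (n N : nat) (t : R) :
  (0 < n <= N)%N -> 0 <= t ->
  n%:R * ln (1 + t / n%:R) <= N%:R * ln (1 + t / N%:R).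
Proof.
move=> /andP[n0 nN] t0.
have n0R : 0 < n%:R :> R by rewrite ltr0n.
have nNR : n%:R <= N%:R :> R by rewrite ler_nat.
have N0R : 0 < N%:R :> R by lra.
have p0 : 0 < 1 + t / n%:R by have := divr_ge0 t0 (ltW n0R); lra.
have q0 : 0 < 1 + t / N%:R by have := divr_ge0 t0 (ltW N0R); lra.
have := ln_le_tangent q0 p0; have := ln_le_tangent q0 ltr01.
rewrite ln1.
set p := 1 + t / n%:R in p0 *; set q := 1 + t / N%:R in q0 *.
have e : n%:R * ((p - q) / q) + (N%:R - n%:R) * ((1 - q) / q) = 0.
  by rewrite /p /q; field; rewrite !gt_eqF//=; nra.
nra.
Qed.

Lemma sum_subr1_le_prod (R : realDomainType) (I : Type) (r : seq I)
    (a : I -> R) :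
  (forall i, 1 <= a i) -> 1 + \sum_(i <- r) (a i - 1) <= \prod_(i <- r) a i.
Proof.
move=> a1.
suff: 0 <= \sum_(i <- r) (a i - 1) /\
      1 + \sum_(i <- r) (a i - 1) <= \prod_(i <- r) a i by case.
elim: r => [|i r [s0 ih]]; first by rewrite !big_nil addr0.
by rewrite !big_cons; have := a1 i; split; nra.
Qed.

Lemma ln_prod (R : realType) (I : Type) (r : seq I) (a : I -> R) :
  (forall i, 0 < a i) -> ln (\prod_(i <- r) a i) = \sum_(i <- r) ln (a i).
Proof.
move=> a0; elim: r => [|i r ih]; first by rewrite !big_nil ln1.
by rewrite !big_cons lnM ?posrE ?prodr_gt0// ih.
Qed.

(** * The scalar inequality *)

(** Any value in the narrow window between the positive root of
    [u ^ 2 - u = 13], about 4.14005, and [14 ^ (7 / 13)], about 4.1414, would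
    do: the lower limit makes [u * (14 - u) / (u - 1)] at most 13, and the upper
    one is [ln_cut_lt]. *)
Definition cut (R : realType) : R := 265 / 64.

Lemma ln_cut_lt (R : realType) : 13 * ln (cut R) < 7 * ln 14.
Proof.
have c0 : 0 < cut R by rewrite /cut; lra.
have -> : 13 * ln (cut R) = ln (cut R ^+ 13) by rewrite lnXn// mulr_natl.
have -> : 7 * ln 14 = ln (14 ^+ 7 : R) by rewrite lnXn// mulr_natl.
rewrite ltr_ln ?posrE ?exprn_gt0//.
by rewrite /cut; lra.
Qed.

(** A crude bound (the true value is about 1.4208), just good enough to make the
    discriminant in [chord_exponent_le] negative.  The base 24 / 23 is close
    enough to 1 for the tangent bound [ln (24 / 23) >= 1 / 24] to be accurate. *)
Lemma ln_cut_ge (R : realType) : 11 / 8 <= ln (cut R).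
Proof.
have c0 : 0 < cut R by rewrite /cut; lra.
have h : (24 / 23 : R) ^+ 33 <= cut R by rewrite /cut; lra.
have : ln ((24 / 23 : R) ^+ 33) <= ln (cut R).
  by rewrite ler_ln ?posrE// exprn_gt0//; lra.
have p : 0 < 24 / 23 :> R by lra.
rewrite lnXn// -[_ *+ 33]mulr_natl.
have := ln_le_tangent p ltr01; rewrite ln1.
lra.
Qed.

(** In [u * (14 - u) / (u - 1) * ln u] the rational factor is at most 13 at
    [cut], and its decrease beyond [cut] outweighs the growth of [ln u].
    Bounding [ln u] by the tangent at [cut], and using
    [cut ^ 2 - cut >= 13], leaves a polynomial inequality with a factor
    [u - cut], whose cofactor is a quadratic in [u] without real roots. *)
Lemma chord_exponent_le (R : realType) (u : R) :
  cut R <= u -> u * (14 - u) * ln u <= 13 * (u - 1) * ln (cut R).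
Proof.
move=> cu; have cE : cut R = 265 / 64 by [].
have c0 : 0 < cut R by rewrite cE; lra.
have lc := ln_cut_ge R; have u0 : 0 < u by lra.
have lu : 0 <= ln u by apply: ln_ge0; lra.
have [u14|u14] := leP 14 u.
  have : u * (14 - u) * ln u <= 0 by apply: mulr_le0_ge0 => //; nra.
  have : 0 <= (u - 1) * ln (cut R) by apply: mulr_ge0; lra.
  lra.
have h0 : 0 <= u * (14 - u) by nra.
apply: le_trans (ler_wpM2l h0 (ln_le_tangent c0 u0)) _.
(* The discriminant is negative because of the lower bound on [ln cut]. *)
have quad : u * (14 - u) <= (u + cut R - 1) * (cut R * (11 / 8)).
  by rewrite cE; nra.
have quad' : u * (14 - u) <= (u + cut R - 1) * (cut R * ln (cut R)).
  apply: le_trans quad _; rewrite ler_wpM2l//; first by lra.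
  by rewrite ler_wpM2l// ltW.
rewrite mulrDr -lerBrDl -mulrBl mulrA ler_pdivrMr//.
set L := ln (cut R) in quad' lc *.
have : (u - cut R) * (u * (14 - u)) <=
  (u - cut R) * ((u + cut R - 1) * (cut R * L)).
  by rewrite ler_wpM2l// subr_ge0.
have : 0 <= (cut R ^+ 2 - cut R - 13) * (cut R * L).
  by apply: mulr_ge0; rewrite cE; nra.
lra.
Qed.

(** With [q = 1 + t / 14] the claim is [(q ^ 7 - 1) / (q - 1) < 14]; the left
    side is a geometric sum, increasing in [q], so only the largest [q]
    matters. *)
Lemma power_lt_add1 (R : realType) (t : R) :
  0 < t -> 14 + t <= cut R ^+ 2 -> (1 + t / 14) ^+ 7 < 1 + t.
Proof.
move=> t0 tc.
set q := 1 + t / 14.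
have q1 : 1 < q by rewrite /q; lra.
have qc : q <= cut R ^+ 2 / 14 by rewrite /q; lra.
have -> : t = 14 * (q - 1) by rewrite /q; field.
rewrite -ltrBlDl subrX1 mulrC ltr_pM2r ?subr_gt0//.
apply: (@le_lt_trans _ _ (\sum_(i < 7) (cut R ^+ 2 / 14) ^+ i)).
  by apply: ler_sum => i _; rewrite lerXn2r// nnegrE; lra.
by rewrite !big_ord_recr big_ord0 /= /cut; lra.
Qed.

(** The upper bound [sqrt S] on the [a i] is what keeps the product large: with
    the sum alone fixed, one large [a i] and the others equal to 1 would violate
    the inequality for large [S]. *)
Lemma sum_ln_gt (R : realType) (n : nat) (a : 'I_n -> R) (S : R) :
  (n <= 14)%N -> (forall i, 1 <= a i) -> (forall i, a i ^+ 2 <= S) ->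
  \sum_i a i = S -> n%:R < S ->
  n%:R / 2 * ln (S / n%:R) < \sum_i ln (a i).
Proof.
move=> n14 a1 aS sumS nS.
have n0 : (0 < n)%N.
  case: (posnP n) => // n0; move: nS; rewrite -sumS.
  by subst n; rewrite big_ord0 ltxx.
have n0R : 0 < n%:R :> R by rewrite ltr0n.
have n14R : n%:R <= 14 :> R by rewrite ler_nat.
have a0 i : 0 < a i by have := a1 i; lra.
set t := S - n%:R.
have t0 : 0 < t by rewrite /t subr_gt0.
have sumt : \sum_i (a i - 1) = t.
  by rewrite sumrB sumS sumr_const card_ord.
have -> : S / n%:R = 1 + t / n%:R by rewrite /t; field; lra.
(* Replace [n] by 14, keeping [t]. *)
suff: 7 * ln (1 + t / 14) < \sum_i ln (a i).
  have nN : (0 < n <= 14)%N by rewrite n0.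
  by have := muln_ln_pad_le nN (ltW t0); lra.
have q0 : 0 < 1 + t / 14 by lra.
pose u := Num.sqrt (14 + t).
have u2 : u ^+ 2 = 14 + t by rewrite sqr_sqrtr//; lra.
have u0 : 0 <= u by apply: sqrtr_ge0.
have au i : a i <= u.
  rewrite -(@ler_pXn2r _ 2) ?nnegrE ?(ltW (a0 i))// u2.
  by apply: le_trans (aS i) _; rewrite /t; lra.
have cE : cut R = 265 / 64 by [].
have [uc|cu] := leP u (cut R).
  (* Small [u]: only the first-order expansion of the product is used. *)
  have : (1 + t / 14) ^+ 7 < \prod_i a i.
    apply: lt_le_trans (sum_subr1_le_prod _ a1); rewrite sumt.
    by apply: power_lt_add1 => //; rewrite -u2 lerXn2r// nnegrE; lra.
  rewrite -ltr_ln ?posrE ?exprn_gt0 ?prodr_gt0// ln_prod// lnXn//.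
  by rewrite -[_ *+ 7]mulr_natl.
have u1 : 0 < u - 1 by lra.
(* Large [u]: each [ln (a i)] lies above the chord over [1, u]. *)
have chord : t * ln u <= (u - 1) * \sum_i ln (a i).
  rewrite -sumt mulr_suml mulr_sumr; apply: ler_sum => i _.
  by apply: ln_ge_chord; rewrite a1 au.
have -> : 7 * ln (1 + t / 14) = 14 * ln u - 7 * ln 14.
  have -> : 1 + t / 14 = u ^+ 2 / 14 by rewrite u2; field.
  by rewrite ln_div ?posrE ?exprn_gt0 ?lnXn//; lra.
rewrite -(ltr_pM2l u1); apply: lt_le_trans chord.
have := chord_exponent_le (ltW cu).
have : (u - 1) * (13 * ln (cut R)) < (u - 1) * (7 * ln 14).
  by rewrite ltr_pM2l// ln_cut_lt.
have -> : t = u ^+ 2 - 14 by rewrite u2; lra.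
lra.
Qed.

(** * The inner product *)

Section Dot.
Variables (R : realType) (d : nat).
Implicit Types x y z : 'rV[R]_d.

Lemma dotvC x y : dotv x y = dotv y x.
Proof. by apply: eq_bigr => i _; rewrite mulrC. Qed.

Lemma dotvDl x y z : dotv (x + y) z = dotv x z + dotv y z.
Proof. by rewrite -big_split; apply: eq_bigr => i _; rewrite mxE mulrDl. Qed.

Lemma dotvZl c x y : dotv (c *: x) y = c * dotv x y.
Proof. by rewrite mulr_sumr; apply: eq_bigr => i _; rewrite mxE mulrA. Qed.

Lemma dotvDr x y z : dotv z (x + y) = dotv z x + dotv z y.
Proof. by rewrite dotvC dotvDl !(dotvC z). Qed.

Lemma dotvZr c x y : dotv x (c *: y) = c * dotv x y.
Proof. by rewrite dotvC dotvZl dotvC. Qed.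

Lemma dotv_sumr x (I : finType) (f : I -> 'rV[R]_d) :
  dotv x (\sum_i f i) = \sum_i dotv x (f i).
Proof.
rewrite /dotv exchange_big; apply: eq_bigr => j _.
by rewrite summxE mulr_sumr.
Qed.

Lemma dotv_ge0 x : 0 <= dotv x x.
Proof. by apply: sumr_ge0 => i _; rewrite -expr2 sqr_ge0. Qed.

Lemma dotv_unit x : enorm x = 1 -> dotv x x = 1.
Proof.
by move=> x1; rewrite -(sqr_sqrtr (dotv_ge0 x)) -/(enorm x) x1 expr1n.
Qed.

(** Cauchy-Schwarz: [x] minus its projection on [y] has nonnegative norm. *)
Lemma dotv_sqr_le x y : dotv y y = 1 -> dotv x y ^+ 2 <= dotv x x.
Proof.
move=> y1; have := dotv_ge0 (x + (- dotv x y) *: y).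
rewrite !(dotvDl, dotvDr, dotvZl, dotvZr) y1 (dotvC y x).
lra.
Qed.

Lemma abs_prod_le_sup n (v : 'I_n -> 'rV[R]_d) x :
  (forall i, enorm (v i) = 1) -> enorm x = 1 ->
  `|\prod_(i < n) dotv x (v i)| <= sup_abs_prod v.
Proof.
move=> v1 x1; apply: ub_le_sup; last by exists x.
exists 1 => _ [y /dotv_unit y1 <-]; rewrite normr_prod.
apply: prodr_ile1 => i _ /=; rewrite normr_ge0 /=.
rewrite -(@ler_pXn2r _ 2) ?nnegrE//= expr1n -normrX ger0_norm ?sqr_ge0//.
rewrite -[leRHS]y1.
by apply: dotv_sqr_le; apply: dotv_unit.
Qed.

(** * Longest signed sums *)

Definition signed_sum n (v : 'I_n -> 'rV[R]_d) (e : {ffun 'I_n -> bool}) :=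
  \sum_i (-1) ^+ e i *: v i.

Definition flip n (e : {ffun 'I_n -> bool}) (j : 'I_n) :=
  [ffun i => e i (+) (i == j)].

Lemma signed_sum_flip n (v : 'I_n -> 'rV[R]_d) (e : {ffun 'I_n -> bool}) j :
  signed_sum v (flip e j) = signed_sum v e + (- 2 * (-1) ^+ e j) *: v j.
Proof.
rewrite /signed_sum (bigD1 j)//= [in RHS](bigD1 j)//= addrAC -scalerDl.
rewrite ffunE eqxx; congr (_ *: _ + _); first by case: (e j) => /=; ring.
by apply: eq_bigr => i /negbTE ij; rewrite ffunE ij addbF.
Qed.

Definition maximal_signs n (v : 'I_n -> 'rV[R]_d) (e : {ffun 'I_n -> bool}) :=
  forall e', dotv (signed_sum v e') (signed_sum v e') <=
             dotv (signed_sum v e) (signed_sum v e).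

Lemma exists_maximal_signs n (v : 'I_n -> 'rV[R]_d) :
  exists e, maximal_signs v e.
Proof.
pose e0 : {ffun 'I_n -> bool} := [ffun=> false].
exists [arg max_(e > e0) dotv (signed_sum v e) (signed_sum v e)]%O => e'.
by case: arg_maxP => // e _; apply.
Qed.

Lemma sum_signed_dotv n (v : 'I_n -> 'rV[R]_d) (e : {ffun 'I_n -> bool}) :
  \sum_i (-1) ^+ e i * dotv (signed_sum v e) (v i) =
  dotv (signed_sum v e) (signed_sum v e).
Proof.
by rewrite {3}/signed_sum dotv_sumr; apply: eq_bigr => i _; rewrite dotvZr.
Qed.

Lemma sqnorm_flip n (v : 'I_n -> 'rV[R]_d) (e : {ffun 'I_n -> bool}) j :
  dotv (v j) (v j) = 1 ->
  dotv (signed_sum v (flip e j)) (signed_sum v (flip e j)) =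
  dotv (signed_sum v e) (signed_sum v e)
    + 4 * (1 - (-1) ^+ e j * dotv (signed_sum v e) (v j)).
Proof.
move=> vj; rewrite signed_sum_flip.
rewrite !(dotvDl, dotvDr, dotvZl, dotvZr) vj (dotvC (v j)).
by case: (e j) => /=; ring.
Qed.

(** Bang's lemma, from the effect of one flip on the squared norm. *)
Lemma maximal_signs_ge1 n (v : 'I_n -> 'rV[R]_d) (e : {ffun 'I_n -> bool}) j :
  dotv (v j) (v j) = 1 -> maximal_signs v e ->
  1 <= (-1) ^+ e j * dotv (signed_sum v e) (v j).
Proof. by move=> vj /(_ (flip e j)); rewrite sqnorm_flip//; lra. Qed.

(** The squared norm is the sum of [n] terms, each at least 1 by
    [maximal_signs_ge1], so here they all equal 1.  Then a flip keeps the squared norm, the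
    flipped signs are maximal too, and the [i]-th terms before and after
    flipping [j] differ by twice [dotv (v j) (v i)], up to sign. *)
Lemma orthonormal_of_maximal_signs n (v : 'I_n -> 'rV[R]_d)
    (e : {ffun 'I_n -> bool}) :
  (forall i, dotv (v i) (v i) = 1) -> maximal_signs v e ->
  dotv (signed_sum v e) (signed_sum v e) <= n%:R -> orthonormal_system v.
Proof.
move=> v1 maxe Sn.
have tight e' : maximal_signs v e' ->
    dotv (signed_sum v e') (signed_sum v e') <= n%:R ->
    forall i, (-1) ^+ e' i * dotv (signed_sum v e') (v i) = 1.
  move=> maxe'; rewrite -sum_signed_dotv => sn i.
  have : \sum_i ((-1) ^+ e' i * dotv (signed_sum v e') (v i) - 1) <= 0.
    by rewrite sumrB sumr_const card_ord subr_le0.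
  have ge0 k : 0 <= (-1) ^+ e' k * dotv (signed_sum v e') (v k) - 1.
    by rewrite subr_ge0 maximal_signs_ge1.
  rewrite (bigD1 i)//=; have := ge0 i.
  have : 0 <= \sum_(k | k != i)
      ((-1) ^+ e' k * dotv (signed_sum v e') (v k) - 1) by apply: sumr_ge0.
  lra.
move=> i j; case: eqVneq => [->|ij] /=; first exact: v1.
have ti := tight e maxe Sn.
have same : dotv (signed_sum v (flip e j)) (signed_sum v (flip e j)) =
    dotv (signed_sum v e) (signed_sum v e).
  by rewrite sqnorm_flip// ti subrr mulr0 addr0.
have := tight (flip e j) _ _ i; rewrite same => /(_ _ Sn).
have maxf : maximal_signs v (flip e j) by move=> e'; rewrite same.
move=> /(_ maxf).
rewrite signed_sum_flip dotvDl dotvZl ffunE (negbTE ij) addbF mulrDr ti.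
rewrite (dotvC (v j)); case: (e i); case: (e j) => /=; lra.
Qed.

End Dot.

(** * Systems with the extremal supremum *)

Theorem theorem3p3 (R : realType) (n : nat) (hn : (2 <= n <= 14)%N)
    (v : 'I_n -> 'rV[R]_n)
    (hv : forall i : 'I_n, enorm (v i) = 1)
    (hsup : sup_abs_prod v = n%:R `^ (- (n%:R / 2))) :
  orthonormal_system v.
Proof.
have /andP[n2 n14] := hn.
have v1 i := dotv_unit (hv i).
have [e maxe] := exists_maximal_signs v.
apply: (orthonormal_of_maximal_signs v1 maxe); rewrite leNgt; apply/negP => nS.
set w := signed_sum v e in nS; set S := dotv w w in nS.
have n0 : 0 < n%:R :> R by rewrite ltr0n; case: (n) n2.
have S0 : 0 < S by lra.
pose a i := (-1) ^+ e i * dotv w (v i).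
have a1 i : 1 <= a i by apply: maximal_signs_ge1.
have a0 i : 0 < a i by have := a1 i; lra.
have aS i : a i ^+ 2 <= S by rewrite exprMn sqrr_sign mul1r dotv_sqr_le.
have big := sum_ln_gt n14 a1 aS (sum_signed_dotv v e) nS.
pose s := Num.sqrt S.
have s0 : 0 < s by rewrite sqrtr_gt0.
have s2 : s ^+ 2 = S by rewrite sqr_sqrtr// ltW.
have x1 : enorm (s^-1 *: w) = 1.
  rewrite /enorm dotvZl dotvZr -/S -s2 expr2 mulKf ?gt_eqF// mulVf ?gt_eqF//.
  exact: sqrtr1.
have := abs_prod_le_sup hv x1; rewrite hsup normr_prod.
have -> : \prod_(i < n) `|dotv (s^-1 *: w) (v i)| = \prod_(i < n) (s^-1 * a i).
  apply: eq_bigr => i _; rewrite dotvZl normrM ger0_norm ?invr_ge0 ?ltW//.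
  by congr (_ * _); rewrite -(gtr0_norm (a0 i)) normrM normr_sign mul1r.
rewrite leNgt => /negP; apply.
rewrite -ltr_ln ?posrE ?powR_gt0 ?prodr_gt0//; first last.
  by move=> i _; rewrite mulr_gt0 ?invr_gt0.
rewrite ln_powR ln_prod => [|i]; last by rewrite mulr_gt0 ?invr_gt0.
under eq_bigr => i _ do rewrite lnM ?posrE ?invr_gt0// lnV ?posrE//.
rewrite big_split /= sumr_const card_ord -[(- ln s) *+ n]mulr_natl.
have : ln S = 2 * ln s by rewrite -s2 lnXn// mulr_natl.
move: big; rewrite ln_div ?posrE// => big lS.
move: big; rewrite lS; set X := \sum_(i < n) _; lra.
Qed.
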